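(* Let $S:[0,\infty)\to[0,\infty]$ be a non-decreasing function with $S(0)=0$, and consider the min-plus linear system with exact service curve $S$, i.e. the system in which every arrival function $A$ produces the departure function $D=A*S$. Let $(A^p,D^p)$ be one pair of arrival and departure functions of this system, and define $$\tilde S = D^p\oslash A^p .$$ Then: (i) $D^p = A^p * \tilde S$; (ii) $\tilde S(t)\le S(t)$ for all $t\ge 0$; (iii) $\tilde S$ is a lower service curve of the system, i.e. $D(t)\ge (A*\tilde S)(t)$ for all $t\ge0$ and all pairs $(A,D)$ of arrival and departure functions of the system.
   Context: Arrival functions are non-decreasing functions $A:[0,\infty)\to[0,\infty]$ with $A(0)=0$. For functions $f,g$ on $[0,\infty)$, the min-plus convolution is $(f*g)(t)=\inf_{0\le\tau\le t}\{f(\tau)+g(t-\tau)\}$ and the min-plus deconvolution is $(f\oslash g)(t)=\sup_{\tau\ge 0}\{f(t+\tau)-g(\tau)\}$, for $t\ge 0$. Convention: values of $\tau$ with $g(\tau)=\infty$ are ignored in the supremum defining $f\oslash g$ (i.e. $x-\infty=-\infty$ for all $x$, including $x=\infty$). *)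

(* Defs.v *)
From HB Require Import structures.
From mathcomp Require Import all_boot all_order all_algebra.
From mathcomp Require Import all_classical all_reals all_analysis.

Set Implicit Arguments.
Unset Strict Implicit.
Unset Printing Implicit Defensive.

Import Order.TTheory GRing.Theory Num.Theory.

Local Open Scope classical_set_scope.
Local Open Scope ring_scope.

(* A function on [0, +oo[ is represented by a function on R whose values at
   negative arguments are irrelevant: every definition below only inspects it
   on [0, +oo[. *)

Definition nonneg_nondecreasing0 (R : realType) (f : R -> \bar R) : Prop :=
  [/\ forall t, 0 <= t -> (0 <= f t)%E,
      forall s t, 0 <= s -> s <= t -> (f s <= f t)%E
    & f 0 = 0%E].

Definition arrival_function (R : realType) (A : R -> \bar R) : Prop :=
  nonneg_nondecreasing0 A.

Definition minplus_conv (R : realType) (f g : R -> \bar R) (t : R) : \bar R :=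
  ereal_inf [set (f tau + g (t - tau)%R)%E | tau in [set u : R | 0 <= u <= t]].

(* In \bar R, x - +oo = -oo for every x, including x = +oo, so the tau with
   g tau = +oo do not contribute to the supremum. *)
Definition minplus_deconv (R : realType) (f g : R -> \bar R) (t : R) : \bar R :=
  ereal_sup [set (f (t + tau)%R - g tau)%E | tau in [set u : R | 0 <= u]].

(* A system is identified with the set of its (arrival, departure) pairs. *)
Definition system (R : realType) := (R -> \bar R) -> (R -> \bar R) -> Prop.

Definition minplus_linear_system (R : realType) (S : R -> \bar R) : system R :=
  fun A D => arrival_function A /\
             forall t, 0 <= t -> D t = minplus_conv A S t.

Definition lower_service_curve (R : realType) (sys : system R)
    (S : R -> \bar R) : Prop :=
  forall A D, sys A D -> forall t, 0 <= t -> (minplus_conv A S t <= D t)%E.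

(* Main.v *)
(** Deconvolution is left adjoint to convolution: [Dp <= Ap * S] gives
    [Dp / Ap <= S], and always [Dp <= Ap * (Dp / Ap)]. Monotonicity of
    convolution then yields all three claims. The value [Ap tau = +oo] is
    harmless in the second inequality because [Dp / Ap >= Dp >= 0]
    (take [tau = 0]). *)
Require Import Defs.
From mathcomp Require Import all_boot all_order all_algebra.
From mathcomp Require Import all_classical all_reals all_analysis.

Set Implicit Arguments.
Unset Strict Implicit.
Unset Printing Implicit Defensive.

Import Order.TTheory GRing.Theory Num.Theory.

Local Open Scope ring_scope.

Lemma le_minplus_conv (R : realType) (f g h : R -> \bar R) :
  (forall t, 0 <= t -> (g t <= h t)%E) ->
  forall t, (minplus_conv f g t <= minplus_conv f h t)%E.
Proof.
move=> gh t; apply: le_ereal_inf_tmp => _ [u /= /andP[u0 ut] <-].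
apply: (@le_trans _ _ (f u + g (t - u)%R)%E).
  by apply: ereal_inf_lbound; exists u => //=; rewrite u0.
by apply: leeD => //; apply: gh; rewrite subr_ge0.
Qed.

Lemma minplus_conv_ge0 (R : realType) (f g : R -> \bar R) (t : R) :
  (forall u, 0 <= u -> (0 <= f u)%E) -> (forall u, 0 <= u -> (0 <= g u)%E) ->
  (0 <= minplus_conv f g t)%E.
Proof.
move=> f0 g0; apply: le_ereal_inf_tmp => _ [u /= /andP[u0 ut] <-].
by apply: adde_ge0; [exact: f0 | apply: g0; rewrite subr_ge0].
Qed.

Lemma minplus_deconv_ge (R : realType) (f g : R -> \bar R) (t : R) :
  g 0 = 0%E -> (f t <= minplus_deconv f g t)%E.
Proof.
by move=> g0; apply: ereal_sup_ubound; exists 0 => /=; rewrite ?g0 ?addr0 ?sube0.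
Qed.

(** The split of [t + u] into [u] and [t] is one candidate in the infimum at [t + u], so
    [f (t + u) <= g u + h t]; subtracting [g u] bounds every term of the supremum. *)
Lemma minplus_deconv_le (R : realType) (f g h : R -> \bar R) :
  (forall t, 0 <= t -> (0 <= g t)%E) ->
  (forall t, 0 <= t -> (f t <= minplus_conv g h t)%E) ->
  forall t, 0 <= t -> (minplus_deconv f g t <= h t)%E.
Proof.
move=> g0 fgh t t0; apply: ge_ereal_sup => _ [u /= u0 <-].
have fu : (f (t + u)%R <= g u + h t)%E.
  apply: le_trans (fgh _ (addr_ge0 t0 u0)) _; apply: ereal_inf_lbound.
  by exists u => /=; rewrite ?addrK // u0 lerDr.
(* Nonnegativity excludes [g u = -oo]; for [g u = +oo] the term of the supremum is [-oo]. *)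
move: (g0 _ u0) fu; case: (g u) => [r | | ] // _ fu.
  by rewrite leeBlDr // addeC.
by rewrite /= addeNy leNye.
Qed.

(** The shift [u] is a candidate in the supremum at [t - u], where it contributes [f t - g u];
    adding [g u] back recovers [f t]. *)
Lemma le_minplus_conv_deconv (R : realType) (f g : R -> \bar R) :
  (forall t, 0 <= t -> (0 <= g t)%E) -> g 0 = 0%E ->
  (forall t, 0 <= t -> (0 <= f t)%E) ->
  forall t, (f t <= minplus_conv g (minplus_deconv f g) t)%E.
Proof.
move=> g_ge0 g0 f0 t; apply: le_ereal_inf_tmp => _ [u /= /andP[u0 ut] <-].
have tu0 : 0 <= t - u by rewrite subr_ge0.
(* This serves the case [g u = +oo]: since [+oo + -oo = -oo] in [\bar R], the deconvolution must
   differ from [-oo] for the sum to be [+oo]. *)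
have dge0 := le_trans (f0 _ tu0) (minplus_deconv_ge f (t - u) g0).
have : (f t - g u <= minplus_deconv f g (t - u)%R)%E.
  by apply: ereal_sup_ubound; exists u => //=; rewrite subrK.
move: (g_ge0 _ u0); case: (g u) => [r | | ] // _.
  by rewrite leeBlDr // addeC.
by move=> _; rewrite addye ?leey // gt_eqF // (lt_le_trans _ dge0) // ltNy0.
Qed.

Theorem mainTheorem2 (R : realType) (S : R -> \bar R)
    (hS : nonneg_nondecreasing0 S)
    (Ap Dp : R -> \bar R) (hp : minplus_linear_system S Ap Dp) :
  let St := minplus_deconv Dp Ap in
  [/\ forall t : R, 0 <= t -> Dp t = minplus_conv Ap St t,
      forall t : R, 0 <= t -> (St t <= S t)%E
    & lower_service_curve (minplus_linear_system S) St].
Proof.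
move=> St; have [hA hD] := hp; have [A_ge0 _ A0] := hA; have [S0 _ _] := hS.
have St_le t : 0 <= t -> (St t <= S t)%E.
  by apply: minplus_deconv_le => // {}t t0; rewrite hD.
split => // [t t0 | A D [_ AD] t t0]; last first.
  by rewrite AD //; exact: le_minplus_conv.
(* The bound from above is the adjunction inequality, with [Dp] nonnegative as a convolution; the
   one from below is [Ap * St <= Ap * S = Dp]. *)
apply/eqP; rewrite eq_le; apply/andP; split.
  apply: le_minplus_conv_deconv => // u u0.
  by rewrite hD //; exact: minplus_conv_ge0.
by rewrite hD //; exact: le_minplus_conv.
Qed.
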